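(* Let $n\ge 4$ be an integer and let $\mathcal L$ be a Lie algebra over a field $\mathbb F$ in the family $\mathrm{Lie}(n,2)$ such that $\dim Z(\mathcal L)=n-4$. Then $\mathcal L=\mathcal M\oplus\mathbb F^{n-k}$ for some integer $4\le k\le 6$ and some Lie algebra $\mathcal M$ belonging to the family $\mathrm{Lie}(k,2)$. Moreover, $\mathcal M$ is isomorphic to one of the following Lie algebras with basis $e_1,\ldots,e_k$ and the indicated non-trivial brackets: $$\mathcal M_{1,k}:\quad [e_1,e_2]=\sum_{i=1}^k a_ie_i,\quad [e_3,e_4]=\sum_{i=1}^k b_ie_i;$$ $$\mathcal M_{2,k}:\quad [e_1,e_2]=\sum_{i=1}^k a_ie_i,\quad [e_1,e_3]=\sum_{i=1}^k b_ie_i,\quad [e_3,e_4]=\sum_{i=1}^k(a_i+\alpha b_i)e_i;$$ $$\mathcal M_{3,k}:\quad [e_1,e_2]=\sum_{i=1}^k a_ie_i,\quad [e_1,e_3]=[e_2,e_4]=\sum_{i=1}^k b_ie_i,\quad [e_3,e_4]=\sum_{i=1}^k(\beta a_i+\gamma b_i)e_i;$$ for some $a_i,b_i,\alpha,\beta,\gamma\in\mathbb F$ such that $(a_1,\ldots,a_k)$ and $(b_1,\ldots,b_k)$ are linearly independent over $\mathbb F$ and, in the case of $\mathcal M_{3,k}$, the polynomial $x^2+\gamma x-\beta$ has no root in $\mathbb F$. Furthermore, the commuting graphs of the Lie algebras $\mathcal M_{1,k}$ and $\mathcal M_{2,k}$ are connected and both have diameter $3$, while the commuting graph of $\mathcal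 M_{3,k}$ is disconnected.
   Context: For a noncommutative (i.e. nonabelian) Lie algebra $\mathcal L$ with center $Z(\mathcal L)$, the commuting graph $\Gamma(\mathcal L)$ is the simple undirected graph with vertex set $V_{\mathcal L}=\mathcal L\setminus Z(\mathcal L)$, in which two distinct vertices $x,y$ are adjacent if and only if $[x,y]=0$. A graph is connected if every pair of distinct vertices is joined by a path, and the diameter of a connected graph is the supremum of the distances (lengths of shortest paths) between distinct vertices. $\mathrm{Lie}(n,k)$ denotes the family of all Lie algebras of dimension $n$ whose derived algebra $\mathcal L^1=[\mathcal L,\mathcal L]$ has dimension $k$. $\oplus$ is the direct sum of Lie algebras, and $\mathbb F^{r}$ is the $r$-dimensional commutative Lie algebra. When a Lie algebra is given by a basis and brackets, all brackets $[e_i,e_j]$ with $i<j$ not listed are zero, and the parameters are understood to be such that the Jacobi identity holds (so that a Lie algebra is indeed defined). *)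

(* Defs.v *)
From HB Require Import structures.
From mathcomp Require Import all_boot all_order all_algebra.

Set Implicit Arguments.
Unset Strict Implicit.
Unset Printing Implicit Defensive.

Import GRing.Theory.
Local Open Scope ring_scope.

(** * Finite-dimensional Lie algebras *)

HB.mixin Record Vector_isLieAlgebra (F : fieldType) L of Vector F L := {
  lbr : L -> L -> L;
  lbr_linearl : forall (a : F) (x y z : L),
    lbr (a *: x + y) z = a *: lbr x z + lbr y z;
  lbr_linearr : forall (a : F) (x y z : L),
    lbr x (a *: y + z) = a *: lbr x y + lbr x z;
  lbrxx : forall x : L, lbr x x = 0;
  lbr_jacobi : forall x y z : L,
    lbr x (lbr y z) + lbr y (lbr z x) + lbr z (lbr x y) = 0
}.

#[short(type="lieAlgType")]
HB.structure Definition LieAlgebra (F : fieldType) :=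
  { L of Vector_isLieAlgebra F L & Vector F L }.

Notation "[ 'lie' x , y ]" := (lbr x y)
  (at level 0, x, y at level 99, format "[ 'lie'  x ,  y ]") : ring_scope.

Section LieTheory.
Variables (F : fieldType) (L : lieAlgType F).

Definition ad (x : L) : 'End(L) := linfun (lbr x).

Definition lie_center : {vspace L} := lker (linfun ad).

Definition lie_derived : {vspace L} :=
  <<[seq [lie x, y] | x <- vbasis {:L}, y <- vbasis {:L}]>>%VS.

Lemma adE (x y : L) : ad x y = [lie x, y].
Proof.
pose M := GRing.isLinear.Build F L L *:%R (lbr x) (fun a => lbr_linearr a x).
pose f : {linear L -> L} := HB.pack (lbr x) M.
exact: (lfunE f).
Qed.

Lemma lie_centerP (x : L) :
  reflect (forall y, [lie x, y] = 0) (x \in lie_center).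
Proof.
have ad_lin : linear ad.
  by move=> a u v; apply/lfunP => w; rewrite add_lfunE scale_lfunE !adE lbr_linearl.
pose M := GRing.isLinear.Build F L 'End(L) *:%R ad ad_lin.
pose f : {linear L -> 'End(L)} := HB.pack ad M.
have -> : (x \in lie_center) = (ad x == 0).
  by rewrite memv_ker; have -> : linfun ad x = ad x by exact: (lfunE f).
apply: (iffP eqP) => [adx0 y|adx0]; first by rewrite -adE adx0 zero_lfunE.
by apply/lfunP => y; rewrite zero_lfunE adE adx0.
Qed.

Lemma mem_lie_derived (x y : L) : [lie x, y] \in lie_derived.
Proof.
rewrite -(adE x y) (coord_vbasis (memvf y)) linear_sum memv_suml // => j _.
rewrite linearZ memvZ //= adE.
have lin : linear (fun u => [lie u, (vbasis {:L})`_j]).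
  by move=> a u v; rewrite lbr_linearl.
pose M := GRing.isLinear.Build F L L *:%R _ lin.
pose f : {linear L -> L} := HB.pack (fun u => [lie u, (vbasis {:L})`_j]) M.
rewrite -[[lie x, _]]/(f x) (coord_vbasis (memvf x)) linear_sum.
rewrite memv_suml // => i _; rewrite linearZ memvZ //= memv_span //.
by apply/allpairsP; exists ((vbasis {:L})`_i, (vbasis {:L})`_j); rewrite !mem_nth ?size_tuple.
Qed.

Lemma lie_derived_sub (U : {vspace L}) :
  (forall x y, [lie x, y] \in U) -> (lie_derived <= U)%VS.
Proof. by move=> UL; apply/span_subvP => _ /allpairsP[[x y] [_ _ ->]]. Qed.

Definition lie_family (n k : nat) : Prop :=
  \dim {:L} = n /\ \dim lie_derived = k.

End LieTheory.

Definition lie_iso (F : fieldType) (L1 L2 : lieAlgType F) : Prop :=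
  exists f : {linear L1 -> L2},
    bijective f /\ forall x y : L1, f [lie x, y] = [lie f x, f y].

(** * Direct sums and commutative Lie algebras *)

Section DirectSum.
Variables (F : fieldType) (L1 L2 : lieAlgType F).

Definition pair_lbr (x y : L1 * L2) : L1 * L2 :=
  ([lie x.1, y.1], [lie x.2, y.2]).

Fact pair_lbr_linearl (a : F) x y z :
  pair_lbr (a *: x + y) z = a *: pair_lbr x z + pair_lbr y z.
Proof. by rewrite /pair_lbr /= !lbr_linearl. Qed.

Fact pair_lbr_linearr (a : F) x y z :
  pair_lbr x (a *: y + z) = a *: pair_lbr x y + pair_lbr x z.
Proof. by rewrite /pair_lbr /= !lbr_linearr. Qed.

Fact pair_lbrxx x : pair_lbr x x = 0.
Proof. by rewrite /pair_lbr !lbrxx. Qed.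

Fact pair_lbr_jacobi x y z :
  pair_lbr x (pair_lbr y z) + pair_lbr y (pair_lbr z x)
    + pair_lbr z (pair_lbr x y) = 0.
Proof. by congr pair; apply: lbr_jacobi. Qed.

HB.instance Definition _ := Vector_isLieAlgebra.Build F (L1 * L2)%type
  pair_lbr_linearl pair_lbr_linearr pair_lbrxx pair_lbr_jacobi.

End DirectSum.

Definition lie_dsum (F : fieldType) (L1 L2 : lieAlgType F) : lieAlgType F :=
  (L1 * L2)%type.

Definition abelian_lie (F : fieldType) (r : nat) : Type := 'rV[F]_r.

Section AbelianLie.
Variables (F : fieldType) (r : nat).

HB.instance Definition _ := Vector.on (abelian_lie F r).

Definition abelian_lbr (x y : abelian_lie F r) : abelian_lie F r := 0.

Fact abelian_lbr_linearl (a : F) x y z :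
  abelian_lbr (a *: x + y) z = a *: abelian_lbr x z + abelian_lbr y z.
Proof. by rewrite /abelian_lbr scaler0 addr0. Qed.

Fact abelian_lbr_linearr (a : F) x y z :
  abelian_lbr x (a *: y + z) = a *: abelian_lbr x y + abelian_lbr x z.
Proof. by rewrite /abelian_lbr scaler0 addr0. Qed.

Fact abelian_lbrxx x : abelian_lbr x x = 0.
Proof. by []. Qed.

Fact abelian_lbr_jacobi x y z :
  abelian_lbr x (abelian_lbr y z) + abelian_lbr y (abelian_lbr z x)
    + abelian_lbr z (abelian_lbr x y) = 0.
Proof. by rewrite /abelian_lbr !addr0. Qed.

HB.instance Definition _ := Vector_isLieAlgebra.Build F (abelian_lie F r)
  abelian_lbr_linearl abelian_lbr_linearr abelian_lbrxx abelian_lbr_jacobi.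

End AbelianLie.

(** * Lie algebras given by a basis and brackets *)

(* A bracket table [c] gives [e_i, e_j] = c i j for i < j only, with 0-based
   indices and in coordinates with respect to the basis e; it is extended to
   all of F^k as an alternating bilinear map. The values c i j with i >= j or
   out of range are never used. *)
Definition bracket_table (F : fieldType) (k : nat) := nat -> nat -> 'rV[F]_k.

Section TableLie.
Variables (F : fieldType) (k : nat) (c : bracket_table F k).

Definition table_lbr (x y : 'rV[F]_k) : 'rV[F]_k :=
  \sum_(i < k) \sum_(j < k | (i < j)%N)
    (x 0 i * y 0 j - x 0 j * y 0 i) *: c i j.

Definition table_jacobi : Prop := forall x y z : 'rV[F]_k,
  table_lbr x (table_lbr y z) + table_lbr y (table_lbr z x)
    + table_lbr z (table_lbr x y) = 0.

Lemma table_lbr_basis (i j : 'I_k) : (i < j)%N ->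
  table_lbr (delta_mx 0 i) (delta_mx 0 j) = c i j.
Proof.
move=> ltij; rewrite /table_lbr (bigD1 i) //= (bigD1 j) //= !big1 ?addr0.
- by rewrite !mxE !eqxx /= -(val_eqE j i) /= (gtn_eqF ltij) mul0r subr0 mul1r scale1r.
- move=> i' ne_i'i; rewrite big1 // => j' lti'j'; rewrite !mxE !eqxx /=.
  rewrite (negPf ne_i'i) mul0r sub0r.
  case: (j' =P i) => [ej|_]; last by rewrite mul0r oppr0 scale0r.
  case: (i' =P j) => [ei|_]; last by rewrite mulr0 oppr0 scale0r.
  by move: lti'j'; rewrite ej ei ltnNge (ltnW ltij).
- move=> j' /andP[_ ne_j'j]; rewrite !mxE !eqxx /= (negPf ne_j'j) mulr0.
  by rewrite -(val_eqE i j) /= (ltn_eqF ltij) mulr0 subr0 scale0r.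
Qed.

Definition table_lie (_ : table_jacobi) : Type := 'rV[F]_k.

Variable J : table_jacobi.

HB.instance Definition _ := Vector.on (table_lie J).

Fact table_lbr_linearl (a : F) x y z :
  table_lbr (a *: x + y) z = a *: table_lbr x z + table_lbr y z.
Proof.
rewrite /table_lbr scaler_sumr -big_split; apply: eq_bigr => i _ /=.
rewrite scaler_sumr -big_split; apply: eq_bigr => j _ /=.
rewrite !mxE scalerA -scalerDl; congr (_ *: _).
by rewrite !mulrDl mulrBr !mulrA opprD addrACA.
Qed.

Fact table_lbrC x y : table_lbr x y = - table_lbr y x.
Proof.
rewrite /table_lbr -sumrN; apply: eq_bigr => i _.
rewrite -sumrN; apply: eq_bigr => j _.
by rewrite -scaleNr opprB [x 0 i * _]mulrC [x 0 j * _]mulrC.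
Qed.

Fact table_lbr_linearr (a : F) x y z :
  table_lbr x (a *: y + z) = a *: table_lbr x y + table_lbr x z.
Proof.
by rewrite table_lbrC table_lbr_linearl opprD -scalerN -!(table_lbrC x).
Qed.

Fact table_lbrxx x : table_lbr x x = 0.
Proof.
rewrite /table_lbr big1 // => i _; rewrite big1 // => j _.
by rewrite [x 0 j * _]mulrC subrr scale0r.
Qed.

HB.instance Definition _ := Vector_isLieAlgebra.Build F (table_lie J)
  table_lbr_linearl table_lbr_linearr table_lbrxx J.

End TableLie.

Section Tables.
Variables (F : fieldType) (k : nat) (a b : 'rV[F]_k).

Definition M1_table : bracket_table F k := fun i j =>
  match i, j with
  | 0, 1 => a
  | 2, 3 => b
  | _, _ => 0
  end.

Definition M2_table (alpha : F) : bracket_table F k := fun i j =>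
  match i, j with
  | 0, 1 => a
  | 0, 2 => b
  | 2, 3 => a + alpha *: b
  | _, _ => 0
  end.

Definition M3_table (beta gamma : F) : bracket_table F k := fun i j =>
  match i, j with
  | 0, 1 => a
  | 0, 2 => b
  | 1, 3 => b
  | 2, 3 => beta *: a + gamma *: b
  | _, _ => 0
  end.

End Tables.

(** * Connectedness and diameter of a possibly infinite simple graph *)

Section Graphs.
Variables (T : eqType) (e : rel T).

(* [x :: p] is the list of vertices of the path; its length is [size p]. *)
Definition graph_path (x y : T) (p : seq T) : bool :=
  [&& path e x p, last x p == y & uniq (x :: p)].

Definition graph_connected : Prop :=
  forall x y : T, x != y -> exists p, graph_path x y p.

Definition graph_dist (x y : T) (d : nat) : Prop :=
  (exists2 p, graph_path x y p & size p = d) /\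
  (forall p, graph_path x y p -> (d <= size p)%N).

Definition dist_bound (m : nat) : Prop :=
  forall (x y : T) (d : nat), x != y -> graph_dist x y d -> (d <= m)%N.

Definition graph_diameter (m : nat) : Prop :=
  dist_bound m /\ forall m', dist_bound m' -> (m <= m')%N.

End Graphs.

Section CommutingGraph.
Variables (F : fieldType) (L : lieAlgType F).

Definition noncentral := {x : L | x \notin lie_center L}.

Definition commuting : rel noncentral := fun x y =>
  (x != y) && ([lie val x, val y] == 0).

End CommutingGraph.
Arguments commuting {F} L.

(* Main.v *)
Require Import Defs.
From HB Require Import structures.
From mathcomp Require Import all_boot all_order all_algebra.
From mathcomp Require Import ring zify.
From Stdlib Require Import Classical.

Set Implicit Arguments.
Unset Strict Implicit.
Unset Printing Implicit Defensive.

Import GRing.Theory.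
Local Open Scope ring_scope.

(** Modulo its center Z, the algebra L is a 4-dimensional space carrying a
    pair of alternating forms, the coordinates of the bracket in the plane D of
    brackets, and these forms have no common radical. Everything comes from a
    normal form of such a pair.

    Two complementary planes <z, w> and <x, y> on which the bracket vanishes
    are found first, with ad z injective on <x, y> ([exists_crossed_frame]).
    The bracket is then carried by the two maps ad z and ad w from <x, y> to D,
    that is by the endomorphism T = (ad z)^-1 (ad w) of the plane <x, y>. If T
    has an eigenvector in F, subtracting a multiple of z from w makes T singular
    and the table M2 appears; otherwise x and T x form a basis, T is a companion
    matrix, its characteristic polynomial has no root, and the table is M3
    ([M2_or_M3_frame]). The algebras with a table M1 are those for which T is
    diagonalizable; in the basis built here they receive a table M2 with nonzero
    alpha.

    Adding to this frame a basis of Z meet (<z, w, x, y> + D) gives a subalgebra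
    of dimension 4, 5 or 6 which is a direct factor of L with a central
    complement, and which is presented by the table in that basis
    ([decomposition]).

    The graphs use the same endomorphism. It extends to L/Z as an operator T
    that is self-adjoint for both forms, and each x commutes with T x. In the
    cases M1 and M2 it satisfies T S = 0 for some S in F[T], and x, T x, S y, y
    is a walk of length 3 ([selfadjoint_pair_diameter3]). In the case M3 it makes
    L/Z a plane over the quadratic field F[T] and the bracket a determinant over
    that field, so that commuting is collinearity, a transitive relation on
    nonzero vectors, and the graph is disconnected ([M3_disconnected]). *)

(** * Brackets and linear algebra *)

Section LieBasics.
Variables (F : fieldType) (L : lieAlgType F).
Implicit Types (x y z : L) (a : F).

Lemma lbrDl x y z : [lie x + y, z] = [lie x, z] + [lie y, z].
Proof. by have := lbr_linearl 1 x y z; rewrite !scale1r. Qed.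

Lemma lbrDr x y z : [lie x, y + z] = [lie x, y] + [lie x, z].
Proof. by rewrite -!adE linearD. Qed.

Lemma lbrZr a x y : [lie x, a *: y] = a *: [lie x, y].
Proof. by rewrite -!adE linearZ. Qed.

Lemma lbrNr x y : [lie x, - y] = - [lie x, y].
Proof. by rewrite -!adE linearN. Qed.

Lemma lbrC x y : [lie x, y] = - [lie y, x].
Proof.
apply/eqP; rewrite -addr_eq0; apply/eqP.
by have := lbrxx (x + y); rewrite lbrDl !lbrDr !lbrxx add0r addr0.
Qed.

Lemma lbrZl a x y : [lie a *: x, y] = a *: [lie x, y].
Proof. by rewrite lbrC lbrZr -scalerN -lbrC. Qed.

Lemma lbrNl x y : [lie - x, y] = - [lie x, y].
Proof. by rewrite lbrC lbrNr -lbrC. Qed.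

Lemma lbr_center x y : y \in lie_center L -> [lie x, y] = 0.
Proof. by move/lie_centerP => yZ; rewrite lbrC yZ oppr0. Qed.

Lemma lbr_eq0C x y : [lie x, y] = 0 -> [lie y, x] = 0.
Proof. by rewrite lbrC => /eqP; rewrite oppr_eq0 => /eqP. Qed.

Lemma lbr_sumr (I : Type) (r : seq I) (f : I -> L) x :
  [lie x, \sum_(i <- r) f i] = \sum_(i <- r) [lie x, f i].
Proof. by rewrite -adE linear_sum; apply: eq_bigr => i _; apply: adE. Qed.

Lemma lbr_suml (I : Type) (r : seq I) (f : I -> L) x :
  [lie \sum_(i <- r) f i, x] = \sum_(i <- r) [lie f i, x].
Proof.
by rewrite lbrC lbr_sumr -sumrN; apply: eq_bigr => i _; rewrite -lbrC.
Qed.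

End LieBasics.

Definition lbrE := (lbrDl, lbrDr, lbrZl, lbrZr, lbrNl, lbrNr).

Section LinearAlgebra.
Variables (F : fieldType) (V : vectType F).

(** Reduces an identity between linear combinations of vectors to an identity in
    F, where [ring] applies; f is a bare function so that the sums obtained are
    those of the field F itself. *)
Lemma functional_ext (u v : V) :
  (forall f : V -> F, (forall x y, f (x + y) = f x + f y) ->
     (forall c x, f (c *: x) = c * f x) -> (forall x, f (- x) = - f x) ->
     f 0 = 0 -> f u = f v) -> u = v.
Proof.
move=> fuv; rewrite (coord_vbasis (memvf u)) (coord_vbasis (memvf v)).
apply: eq_bigr => i _; congr (_ *: _).
apply: (fuv (coord (vbasis {:V}) i)) => [x y|c x|x|];
  by rewrite (linearD, scalarZ, linearN, linear0).
Qed.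

Lemma free2P (a b : V) :
  reflect (forall c d : F, c *: a + d *: b = 0 -> c = 0 /\ d = 0)
          (free [:: a; b]).
Proof.
apply: (iffP (@freeP _ _ 2 [tuple a; b])) => [H c d cd0 | H k].
  pose k := [fun i : 'I_2 => if i == 0 then c else d].
  have := H k; rewrite !big_ord_recl big_ord0 /= addr0 => /(_ cd0) k0.
  by have := k0 0; have := k0 1.
rewrite !big_ord_recl big_ord0 /= addr0 => /H[k0 k1].
case=> [[|[|//]] lti]; [rewrite -[RHS]k0 | rewrite -[RHS]k1];
  congr k; exact: val_inj.
Qed.

Lemma free2_scale (a b : V) : a != 0 -> ~~ free [:: a; b] -> exists t : F, b = t *: a.
Proof.
move=> a0; rewrite free_cons seq1_free span_seq1.
case: (eqVneq b 0) => [-> _|b0]; first by exists 0; rewrite scale0r.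
rewrite andbT negbK => /vlineP[t at_]; exists t^-1.
rewrite at_ scalerA mulVf ?scale1r //.
by apply/eqP => t0; rewrite at_ t0 scale0r eqxx in a0.
Qed.

Lemma free_neq0 (a b : V) : free [:: a; b] -> a != 0.
Proof. by move/free_not0; apply; rewrite mem_head. Qed.

Lemma freeC (a b : V) : free [:: a; b] = free [:: b; a].
Proof. by apply: perm_free; rewrite (perm_catC [:: a] [:: b]). Qed.

Lemma span2P (a b v : V) :
  reflect (exists c d, v = c *: a + d *: b) (v \in <<[:: a; b]>>%VS).
Proof.
rewrite span_cons span_seq1; apply: (iffP memv_addP).
  by case=> _ /vlineP[c ->] [_ /vlineP[d ->] ->]; exists c, d.
case=> c [d ->]; exists (c *: a); first by rewrite memvZ ?memv_line.
by exists (d *: b); rewrite ?memvZ ?memv_line.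
Qed.

Lemma span_dim2 (D : {vspace V}) (a b v : V) : \dim D = 2%N -> free [:: a; b] ->
  a \in D -> b \in D -> v \in D -> exists c d, v = c *: a + d *: b.
Proof.
move=> dD fab aD bD vD; apply/span2P.
have /eqP -> // : <<[:: a; b]>>%VS == D.
rewrite eqEdim dD (eqnP fab) /= andbT.
by apply/span_subvP => u; rewrite !inE => /orP[] /eqP->.
Qed.

Lemma span4P (e1 e2 e3 e4 v : V) :
  v \in <<[:: e1; e2; e3; e4]>>%VS ->
  exists c1 c2 c3 c4, v = c1 *: e1 + c2 *: e2 + c3 *: e3 + c4 *: e4.
Proof.
rewrite (span_cat [:: e1; e2] [:: e3; e4]).
case/memv_addP => _ /span2P[c1 [c2 ->]] [_ /span2P[c3 [c4 ->]] ->].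
by exists c1, c2, c3, c4; rewrite !addrA.
Qed.

End LinearAlgebra.

Ltac vec_ring :=
  let f := fresh "f" in let fD := fresh in let fZ := fresh in
  let fN := fresh in let f0 := fresh in
  apply: functional_ext => f fD fZ fN f0;
  rewrite ?(fD, fZ, fN, f0); ring.

(** * Normal form of the bracket modulo the center *)

Section Frames.
Variables (F : fieldType) (L : lieAlgType F).
Local Notation Z := (lie_center L).
Local Notation D := (lie_derived L).
Hypothesis dimD : \dim D = 2%N.
Hypothesis codimZ : \dim {:L} = (\dim Z + 4)%N.
Implicit Types x y z w u v : L.

Lemma derived_span a b x y : free [:: a; b] -> a \in D -> b \in D ->
  exists c d, [lie x, y] = c *: a + d *: b.
Proof. by move=> fab aD bD; apply: span_dim2 aD bD _; rewrite ?mem_lie_derived. Qed.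

(** Take two independent brackets [u, v] and [r, s]. If none of the maps ad u,
    ad v, ad r, ad s has rank 2 then [u, s] and [r, v] lie in two distinct lines
    at once, hence vanish, and ad (u + r) maps v and s to the two brackets. *)
Lemma exists_rank2 : exists x u v, free [:: [lie x, u]; [lie x, v]].
Proof.
have brNsub (U : {vspace L}) : (\dim U < 2)%N -> exists x y, [lie x, y] \notin U.
  move=> dU; apply: NNPP => no.
  have /lie_derived_sub/dimvS : forall x y, [lie x, y] \in U.
    by move=> x y; apply: contraT => xyU; case: no; exists x, y.
  by rewrite dimD leqNgt dU.
have [u [v]] : exists x y : L, [lie x, y] \notin 0%VS by apply: brNsub; rewrite dimv0.
rewrite memv0 => uv0.
have [r [s rsNuv]] : exists x y : L, [lie x, y] \notin <[ [lie u, v] ]>%VS.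
  by apply: brNsub; rewrite dim_vline; case: eqP.
have fab : free [:: [lie u, v]; [lie r, s]].
  by rewrite freeC free_cons span_seq1 rsNuv seq1_free.
have rs0 : [lie r, s] != 0 by apply: contraNneq rsNuv => ->; rewrite mem0v.
have cross p : p \in <[ [lie u, v] ]>%VS -> p \in <[ [lie r, s] ]>%VS -> p = 0.
  case/vlineP => c -> /vlineP[d /eqP]; rewrite -subr_eq0 -scaleNr => /eqP.
  by case/(free2P _ _ fab) => ->; rewrite scale0r.
apply: NNPP => no.
have all_rank1 x p q : [lie x, p] != 0 -> [lie x, q] \in <[ [lie x, p] ]>%VS.
  move=> xp0; apply: contraT => xqN; case: no; exists x, p, q.
  by rewrite freeC free_cons span_seq1 xqN seq1_free.
have vu0 : [lie v, u] != 0 by rewrite lbrC oppr_eq0.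
have sr0 : [lie s, r] != 0 by rewrite lbrC oppr_eq0.
have us0 : [lie u, s] = 0.
  apply: cross; first exact: all_rank1.
  rewrite lbrC memvN; have /vlineP[c ->] := all_rank1 s r u sr0.
  by rewrite lbrC scalerN -scaleNr memvZ // memv_line.
have rv0 : [lie r, v] = 0.
  apply: cross; last exact: all_rank1.
  rewrite lbrC memvN; have /vlineP[c ->] := all_rank1 v u r vu0.
  by rewrite lbrC scalerN -scaleNr memvZ // memv_line.
by apply: no; exists (u + r), v, s; rewrite !lbrDl us0 rv0 addr0 add0r.
Qed.

(** The kernel of ad z has codimension at most 2 in L, since ad z maps into the
    plane of brackets, whereas Z + <z> has codimension at least 3. *)
Lemma exists_commuting z : exists2 w, [lie z, w] = 0 & w \notin (Z + <[z]>)%VS.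
Proof.
have rk : (\dim (limg (ad z)) <= 2)%N.
  rewrite -dimD dimvS //; apply/subvP => _ /memv_imgP[y _ ->].
  by rewrite adE mem_lie_derived.
have dk : (\dim Z + 2 <= \dim (lker (ad z)))%N.
  by have := limg_ker_dim (ad z) {:L}; rewrite capfv codimZ; lia.
have /subvPn[w wk wN] : ~~ (lker (ad z) <= Z + <[z]>)%VS.
  apply/negP => /dimvS; have [] := dimv_add_leqif Z <[z]>%VS.
  by rewrite dim_vline; lia.
by exists w => //; rewrite -adE; apply/eqP; rewrite -memv_ker.
Qed.

Lemma center_line_neq0 z w : w \notin (Z + <[z]>)%VS ->
  forall c d, c *: z + d *: w \in Z -> d = 0.
Proof.
move=> wN c d cdZ; apply/eqP; apply: contraNT wN => d0.
apply/memv_addP; exists (d^-1 *: (c *: z + d *: w)); first exact: memvZ.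
exists (- (d^-1 * c) *: z); first by rewrite memvZ ?memv_line.
by rewrite scalerDr !scalerA mulVf // scale1r scaleNr addrAC subrr add0r.
Qed.

Section Frame.
Variables z w x y : L.
Hypothesis zw : [lie z, w] = 0.
Hypothesis wN : w \notin (Z + <[z]>)%VS.
Hypothesis fxy : free [:: [lie z, x]; [lie z, y]].

(** Applying ad z, which kills z, w and Z, isolates the coefficients of x and
    y. *)
Lemma frame_indep c1 c2 c3 c4 : c1 *: z + c2 *: w + c3 *: x + c4 *: y \in Z ->
  [/\ c1 = 0, c2 = 0, c3 = 0 & c4 = 0].
Proof.
move=> cZ.
have [c30 c40] : c3 = 0 /\ c4 = 0.
  apply: (free2P _ _ fxy); have := lbr_center z cZ.
  by rewrite !lbrE lbrxx zw !scaler0 !add0r.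
rewrite c30 c40 !scale0r !addr0 in cZ.
have c20 := center_line_neq0 wN cZ; split=> //.
rewrite c20 scale0r addr0 in cZ.
apply/eqP; apply: contraT => c10.
have: [lie z, x] != 0 by apply: free_neq0 fxy.
by have /lie_centerP/(_ x)/eqP := cZ; rewrite lbrZl scaler_eq0 (negPf c10) => /= ->.
Qed.

Lemma frame_span :
  [/\ free [:: z; w; x; y], (Z :&: <<[:: z; w; x; y]>> = 0)%VS
    & (Z + <<[:: z; w; x; y]>> = fullv)%VS].
Proof.
have fX : free [:: z; w; x; y].
  apply/(@freeP _ _ 4 [tuple z; w; x; y]) => k.
  rewrite !big_ord_recl big_ord0 /= addr0 !addrA => k0.
  have [|k1 k2 k3 k4] := @frame_indep (k ord0) (k (lift ord0 ord0))
    (k (lift ord0 (lift ord0 ord0)))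
    (k (lift ord0 (lift ord0 (lift ord0 ord0)))).
    by rewrite k0 mem0v.
  case=> [[|[|[|[|//]]]] lti]; [rewrite -[RHS]k1 | rewrite -[RHS]k2
    | rewrite -[RHS]k3 | rewrite -[RHS]k4]; congr k; exact: val_inj.
have cap0 : (Z :&: <<[:: z; w; x; y]>> = 0)%VS.
  apply/eqP; rewrite -subv0; apply/subvP => v; rewrite memv_cap => /andP[vZ].
  case/span4P => [c1 [c2 [c3 [c4 ev]]]]; rewrite ev in vZ *.
  by have [-> -> -> ->] := frame_indep vZ; rewrite !scale0r !addr0 mem0v.
split=> //; apply/eqP; rewrite eqEdim subvf /= dimv_disjoint_sum //.
by rewrite (eqnP fX) codimZ.
Qed.

Lemma frame_center v : [lie v, z] = 0 -> [lie v, w] = 0 ->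
  [lie v, x] = 0 -> [lie v, y] = 0 -> v \in Z.
Proof.
move=> vz vw vx vy; apply/lie_centerP => t.
have [_ _ full] := frame_span.
have := memvf t; rewrite -full => /memv_addP[s sZ [r /span4P]].
case=> [c1 [c2 [c3 [c4 ->]]]] ->.
by rewrite lbrDr (lbr_center v sZ) !lbrE vz vw vx vy !scaler0 !addr0.
Qed.

End Frame.

(** The bracket vanishes on both planes <z, w> and <x, y>, so that it is
    determined by the restrictions of ad z and ad w to <x, y>. *)
Definition crossed_frame z w x y :=
  [/\ [lie z, w] = 0, [lie x, y] = 0, w \notin (Z + <[z]>)%VS
    & free [:: [lie z, x]; [lie z, y]]].

(** Choose x with ad x of rank 2, then u and v with [x, u] and [x, v]
    independent, and y commuting with x. If neither ad u nor ad v is injective on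
    <x, y>, each of them kills one of the vectors y - l x and y - m x. These
    vectors differ, as otherwise they would be central, and then ad (u + v) is
    injective on <x, y>. So some z has ad z injective on <x, y>, and any w
    commuting with z completes the frame. *)
Lemma exists_crossed_frame : exists z w x y, crossed_frame z w x y.
Proof.
have [x [u [v fuv]]] := exists_rank2.
have [y xy yN] := exists_commuting x.
suff [z fz] : exists z, free [:: [lie z, x]; [lie z, y]].
  by have [w zw wN] := exists_commuting z; exists z, w, x, y.
have x0 t s : free [:: [lie x, t]; [lie x, s]] -> [lie t, x] != 0.
  by move=> f; rewrite lbrC oppr_eq0; apply: free_neq0 f.
apply: NNPP => no.
have [l ul] : exists l : F, [lie u, y] = l *: [lie u, x].
  by apply: free2_scale; [apply: x0 fuv | apply/negP => fu; apply: no; exists u].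
have [m vm] : exists m : F, [lie v, y] = m *: [lie v, x].
  apply: free2_scale; last by apply/negP => fu; apply: no; exists v.
  by move: fuv; rewrite freeC; apply: x0.
have [lm|lm] := eqVneq l m.
  apply: (negP yN); apply/memv_addP; exists (y - l *: x).
    have yx := lbr_eq0C xy.
    apply: (frame_center xy yN fuv); rewrite ?lbrE ?lbrxx ?yx ?xy ?scaler0 ?subr0 //.
    - by rewrite (lbrC y) (lbrC x) ul scalerN opprK addrC subrr.
    - by rewrite (lbrC y) (lbrC x) vm lm scalerN opprK addrC subrr.
  by exists (l *: x); rewrite ?memvZ ?memv_line // subrK.
apply: no; exists (u + v); apply/free2P => c d.
rewrite !lbrDl ul vm => cd0.
have [] := free2P _ _ fuv (c + d * l) (c + d * m).
  move: cd0; rewrite (lbrC u) (lbrC v) => cd0.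
  by rewrite -[RHS]oppr0 -[in RHS]cd0; vec_ring.
move=> e1 e2; have: d * (l - m) = (c + d * l) - (c + d * m) by ring.
rewrite e1 e2 subrr => /eqP; rewrite mulf_eq0 subr_eq0 (negPf lm) orbF => /eqP d0.
by move: e1; rewrite d0 mul0r addr0.
Qed.

(** With [e1, e4] = [e2, e3] = 0, which a crossed frame e1, e4, e2, e3 provides,
    these are the brackets of the tables M2 and M3 for a = [e1, e2] and
    b = [e1, e3]. *)
Definition M2_frame (e1 e2 e3 e4 : L) := exists alpha : F,
  [lie e2, e4] = 0 /\ [lie e3, e4] = [lie e1, e2] + alpha *: [lie e1, e3].

Definition M3_frame (e1 e2 e3 e4 : L) := exists beta gamma : F,
  [/\ forall t : F, ~~ root ('X^2 + gamma *: 'X - beta%:P) t,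
      [lie e2, e4] = [lie e1, e3]
    & [lie e3, e4] = beta *: [lie e1, e2] + gamma *: [lie e1, e3]].

(** Here v is an eigenvector of T = (ad z)^-1 (ad w) for the eigenvalue t. *)
Lemma frame_of_eigenvector z w v v' (t : F) : crossed_frame z w v v' ->
  [lie w, v] = t *: [lie z, v] ->
  exists e1 e2 e3 e4, crossed_frame e1 e4 e2 e3 /\ M2_frame e1 e2 e3 e4.
Proof.
case=> zw vv' wN fr wv.
(* In the frame z, w', v, v' the endomorphism T becomes T - t and kills v. *)
pose w' := w - t *: z.
have zw' : [lie z, w'] = 0 by rewrite !lbrE zw lbrxx scaler0 subr0.
have w'v : [lie w', v] = 0 by rewrite !lbrE wv subrr.
have w'N : w' \notin (Z + <[z]>)%VS.
  apply: contra wN => w'Z; rewrite -(subrK (t *: z) w) memvD //.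
  by rewrite memvZ // (subvP (addvSr _ _)) // memv_line.
have [p [q w'v']] : exists p q : F, [lie w', v'] = p *: [lie z, v] + q *: [lie z, v'].
  by apply: derived_span fr _ _; apply: mem_lie_derived.
(* When p = 0 the vectors v and v' are eigenvectors of T - t for 0 and q, and
   q is nonzero; the vector v' + v is not an eigenvector. *)
wlog p0 : v' p q vv' fr w'v' / p != 0.
  move=> IH; have [p0|] := eqVneq p 0; last exact: IH w'v'.
  apply: (IH (v' + v) (- q) q).
  - by rewrite lbrDr vv' lbrxx addr0.
  - apply/free2P => c d cd0; have [] := free2P _ _ fr (c + d) d.
      by rewrite -[RHS]cd0 lbrDr; vec_ring.
    by move=> + d0; rewrite d0 addr0.
  - by rewrite !lbrDr w'v w'v' p0; vec_ring.
  rewrite oppr_eq0; apply/eqP => q0; apply: (negP w'N).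
  apply: (subvP (addvSl _ _)); apply: (frame_center zw' w'N fr) => //.
  - exact: lbr_eq0C.
  - exact: lbrxx.
  - by rewrite w'v' p0 q0 !scale0r addr0.
(* Scaling v by - p makes the coefficient of [e1, e2] in [e3, e4] equal to 1. *)
exists z, (- p *: v), v', w'; split; last (exists (- q); split).
- split=> //; first by rewrite lbrZl vv' scaler0.
  apply/free2P => c d cd0; have [] := free2P _ _ fr (c * - p) d.
    by rewrite -[RHS]cd0 lbrZr; vec_ring.
  by move/eqP; rewrite mulf_eq0 oppr_eq0 (negPf p0) orbF => /eqP.
- by rewrite lbrZl (lbr_eq0C w'v) scaler0.
- by rewrite lbrC w'v' !lbrE; vec_ring.
Qed.

(** If x is not an eigenvector of T = (ad z)^-1 (ad w), the basis x, - T x puts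
    T in companion form, with characteristic polynomial X^2 + gamma X - beta. *)
Lemma M2_or_M3_frame : exists e1 e2 e3 e4,
  crossed_frame e1 e4 e2 e3 /\ (M2_frame e1 e2 e3 e4 \/ M3_frame e1 e2 e3 e4).
Proof.
have [z [w [x [y]]]] := exists_crossed_frame; case=> zw xy wN fr.
have eigen v v' (t : F) : crossed_frame z w v v' -> [lie w, v] = t *: [lie z, v] ->
  exists e1 e2 e3 e4,
  crossed_frame e1 e4 e2 e3 /\ (M2_frame e1 e2 e3 e4 \/ M3_frame e1 e2 e3 e4).
  move=> fvv' wv; have [e1 [e2 [e3 [e4 [ef M2]]]]] := frame_of_eigenvector fvv' wv.
  by exists e1, e2, e3, e4; split=> //; left.
have [p [q wx]] : exists p q : F, [lie w, x] = p *: [lie z, x] + q *: [lie z, y].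
  by apply: derived_span fr _ _; apply: mem_lie_derived.
have [q0|q0] := eqVneq q 0.
  by apply: (@eigen x y p) => //; rewrite wx q0 scale0r addr0.
pose e3 := - (p *: x + q *: y).
have ze3 : [lie z, e3] = [lie x, w].
  by rewrite (lbrC x) wx !lbrE.
have xe3 : [lie x, e3] = 0 by rewrite !lbrE lbrxx xy !scaler0 addr0 oppr0.
have fr' : free [:: [lie z, x]; [lie z, e3]].
  apply/free2P => c d cd0; have [] := free2P _ _ fr (c - d * p) (- (d * q)).
    by rewrite -[RHS]cd0 !lbrE; vec_ring.
  move=> + /eqP; rewrite oppr_eq0 mulf_eq0 (negPf q0) orbF => + /eqP d0.
  by rewrite d0 mul0r subr0.
have [beta [gamma e3w]] : exists b c : F,
    [lie e3, w] = b *: [lie z, x] + c *: [lie z, e3].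
  by apply: derived_span fr' _ _; apply: mem_lie_derived.
have [[t rt]|noroot] := classic (exists t : F, root ('X^2 + gamma *: 'X - beta%:P) t).
  have eb : beta = t * (t + gamma).
    move: rt; rewrite /root !hornerE subr_eq0 => /eqP <-; ring.
  (* The companion matrix maps e3 - (t + gamma) x to t times itself. *)
  apply: (@eigen (e3 - (t + gamma) *: x) x t).
    split=> //; first by rewrite lbrDl lbrNl lbrZl lbrxx lbr_eq0C // scaler0 subr0.
    apply/free2P => c d cd0; have [] := free2P _ _ fr' (d - c * (t + gamma)) c.
      by rewrite -[RHS]cd0 !lbrE; vec_ring.
    by move=> + c0; rewrite c0 mul0r subr0.
  rewrite lbrC lbrDl lbrNl lbrZl e3w -ze3 eb !lbrE; vec_ring.
exists z, x, e3, w; split=> //; right; exists beta, gamma; split=> //.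
by move=> t; apply/negP => rt; apply: noroot; exists t.
Qed.

End Frames.

(** * Realizing a Lie algebra by a bracket table *)

Section Realization.
Variables (F : fieldType) (L : lieAlgType F) (k r : nat).
Variables (E : k.-tuple L) (G : r.-tuple L) (c : bracket_table F k).
Hypothesis basisEG : basis_of {:L} (E ++ G).
Hypothesis G_central : forall j : 'I_r, G`_j \in lie_center L.

Definition lincomb m (X : m.-tuple L) (x : 'rV[F]_m) : L :=
  \sum_(i < m) x 0 i *: X`_i.

Hypothesis bracketE : forall i j : 'I_k, (i < j)%N ->
  [lie E`_i, E`_j] = lincomb E (c i j).

Lemma lincomb_linear m (X : m.-tuple L) : linear (lincomb X).
Proof.
move=> a x y; rewrite /lincomb scaler_sumr -big_split; apply: eq_bigr => i _ /=.
by rewrite !mxE scalerDl scalerA.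
Qed.

HB.instance Definition _ m (X : m.-tuple L) :=
  GRing.isLinear.Build F 'rV[F]_m L *:%R (lincomb X) (lincomb_linear X).

Lemma coord_lincomb m (X : m.-tuple L) x i : free X -> coord X i (lincomb X x) = x 0 i.
Proof. by move=> fX; rewrite coord_sum_free. Qed.

Lemma lincomb_coord m (X : m.-tuple L) v : v \in <<X>>%VS ->
  lincomb X (\row_i coord X i v) = v.
Proof.
by move=> vX; rewrite [RHS](coord_span vX); apply: eq_bigr => i _; rewrite mxE.
Qed.

Lemma lincomb_inj m (X : m.-tuple L) : free X -> injective (lincomb X).
Proof. by move=> fX x y e; apply/rowP => i; rewrite -!(coord_lincomb _ _ fX) e. Qed.

(** The terms (i, j) and (j, i) of the double sum are grouped: the table only
    holds the brackets with i < j. *)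
Lemma lincomb_table x y :
  [lie lincomb E x, lincomb E y] = lincomb E (table_lbr c x y).
Proof.
rewrite {1 2}/lincomb lbr_suml; under eq_bigr do rewrite lbr_sumr.
rewrite /table_lbr linear_sum.
under [RHS]eq_bigr do rewrite linear_sum.
pose h i j := (x 0 i * y 0 j) *: [lie E`_i, E`_j].
have -> : \sum_(i < k) \sum_(j < k) [lie x 0 i *: E`_i, y 0 j *: E`_j] =
    \sum_(i < k) \sum_(j < k) h i j.
  by apply: eq_bigr => i _; apply: eq_bigr => j _; rewrite lbrZl lbrZr scalerA.
have -> : \sum_(i < k) \sum_(j < k) h i j =
    \sum_(i < k) \sum_(j < k | (i < j)%N) (h i j + h j i).
  under [RHS]eq_bigr do rewrite big_split.
  rewrite big_split /= [X in _ + X](exchange_big_dep predT) //= -big_split /=.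
  apply: eq_bigr => i _; rewrite (bigID (fun j : 'I_k => (i < j)%N)) /=; congr (_ + _).
  rewrite (bigID (fun j : 'I_k => (j < i)%N)) /= [X in _ + X]big1 ?addr0.
    by apply: eq_bigl => j; case: ltngtP.
  move=> j; rewrite -!leqNgt -eqn_leq => /eqP/val_inj->.
  by rewrite /h lbrxx scaler0.
apply: eq_bigr => i _; apply: eq_bigr => j ltij.
rewrite linearZ /= -bracketE // /h [ [lie E`_j, _] ]lbrC scalerN -scaleNr.
by rewrite -scalerDl [x 0 j * _]mulrC.
Qed.

Let freeE : free E.
Proof. exact: catl_free (basis_free basisEG). Qed.

(** [lincomb E] embeds the table in L and transports the bracket, so the Jacobi
    identity of the table is that of L. *)
Lemma table_jacobi_of_basis : table_jacobi c.
Proof.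
move=> x y z; apply: (lincomb_inj freeE).
by rewrite !linearD linear0 /= -!lincomb_table lbr_jacobi.
Qed.

Lemma lie_iso_of_basis :
  lie_iso L (lie_dsum (table_lie table_jacobi_of_basis) (abelian_lie F r)).
Proof.
set J := table_jacobi_of_basis.
pose B := cat_tuple E G.
have fB : free B := basis_free basisEG.
pose f (l : L) : lie_dsum (table_lie J) (abelian_lie F r) :=
  (\row_i coord B (lshift r i) l, \row_j coord B (rshift k j) l).
have f_lin : linear f.
  move=> a u v; rewrite /f; congr pair; apply/rowP => i;
    by rewrite !mxE linearD linearZ.
pose M := GRing.isLinear.Build F L (lie_dsum (table_lie J) (abelian_lie F r))
  *:%R f f_lin.
pose fl : {linear L -> lie_dsum (table_lie J) (abelian_lie F r)} :=
  HB.pack f M.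
pose g (p : 'rV[F]_k * 'rV[F]_r) : L := lincomb E p.1 + lincomb G p.2.
have gE p : g p = lincomb B (row_mx p.1 p.2).
  rewrite /g /lincomb big_split_ord; congr (_ + _); apply: eq_bigr => i _ /=.
    by rewrite row_mxEl nth_cat size_tuple ltn_ord.
  by rewrite row_mxEr nth_cat size_tuple ltnNge leq_addr addKn.
have gK : cancel g f.
  case=> x y; rewrite gE /f /=; congr pair; apply/rowP => i;
    by rewrite mxE coord_lincomb // (row_mxEl, row_mxEr).
have fK : cancel f g.
  move=> l; rewrite gE /= -[RHS](@lincomb_coord _ B l) ?(span_basis basisEG) ?memvf //.
  by congr lincomb; apply/rowP => i; rewrite !mxE; case: splitP => j ej; rewrite !mxE;
    congr (coord B _ l); apply: val_inj.
have Gc y : lincomb G y \in lie_center L.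
  by apply: memv_suml => i _; rewrite memvZ.
exists fl; split; first by exists g.
move=> u v; apply: (can_inj gK).
rewrite (fK [lie u, v]).
have -> : [lie fl u, fl v] = (table_lbr c (fl u).1 (fl v).1, 0) by [].
rewrite {1}/g /= linear0 addr0 -lincomb_table -{1}[u]fK -{1}[v]fK /g.
rewrite !lbrDr (lbr_center _ (Gc _)) addr0 lbrDl.
by move: (Gc (fl u).2) => /lie_centerP->; rewrite addr0.
Qed.

End Realization.

Section TableFamily.
Variables (F : fieldType) (k : nat) (c : bracket_table F k) (J : table_jacobi c).
Variables (a b : 'rV[F]_k).

Lemma table_lie_family : (2 < k)%N -> free [:: a; b] ->
  c 0%N 1%N = a -> c 0%N 2%N = b ->
  (forall i j, c i j \in <<[:: a; b]>>%VS) -> lie_family (table_lie J) k 2.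
Proof.
move=> k2 fab ca cb cab; split; first by rewrite dimvf; apply: mul1n.
have -> : lie_derived (table_lie J) = <<[:: a; b]>>%VS; last exact: eqnP fab.
apply/eqP; rewrite eqEsubv; apply/andP; split.
  apply: lie_derived_sub => x y; rewrite -[[lie x, y]]/(table_lbr c x y).
  by apply: memv_suml => i _; apply: memv_suml => j _; rewrite memvZ.
have k0 : (0 < k)%N by lia.
have k1 : (1 < k)%N by lia.
have mem (i j : 'I_k) : (i < j)%N -> c i j \in lie_derived (table_lie J).
  by move=> ltij; rewrite -table_lbr_basis //; apply: mem_lie_derived.
apply/span_subvP => u; rewrite !inE => /orP[] /eqP->.
  by rewrite -ca; apply: (mem (Ordinal k0) (Ordinal k1)).
by rewrite -cb; apply: (mem (Ordinal k0) (Ordinal k2)).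
Qed.

End TableFamily.

Section Tables.
Variables (F : fieldType) (k : nat) (a b : 'rV[F]_k).

Lemma M1_table_tail i j : M1_table a b i (j + 4)%N = 0.
Proof. by rewrite addn4; case: i => [|[|[|i]]]. Qed.

Lemma M2_table_tail alpha i j : M2_table a b alpha i (j + 4)%N = 0.
Proof. by rewrite addn4; case: i => [|[|[|i]]]. Qed.

Lemma M3_table_tail beta gamma i j : M3_table a b beta gamma i (j + 4)%N = 0.
Proof. by rewrite addn4; case: i => [|[|[|i]]]. Qed.

Let mem_a : a \in <<[:: a; b]>>%VS.
Proof. by rewrite memv_span ?mem_head. Qed.

Let mem_b : b \in <<[:: a; b]>>%VS.
Proof. by rewrite memv_span ?inE ?eqxx ?orbT. Qed.

Lemma M2_table_span alpha i j : M2_table a b alpha i j \in <<[:: a; b]>>%VS.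
Proof.
case: i j => [|[|[|i]]] [|[|[|[|j]]]] /=; rewrite ?mem0v //.
by rewrite memvD ?memvZ.
Qed.

Lemma M3_table_span beta gamma i j :
  M3_table a b beta gamma i j \in <<[:: a; b]>>%VS.
Proof.
case: i j => [|[|[|i]]] [|[|[|[|j]]]] /=; rewrite ?mem0v //.
by rewrite memvD ?memvZ.
Qed.

End Tables.

(** * The direct sum decomposition *)

Section Decomposition.
Variables (F : fieldType) (L : lieAlgType F).
Local Notation Z := (lie_center L).
Local Notation D := (lie_derived L).
Hypothesis dimD : \dim D = 2%N.
Hypothesis codimZ : \dim {:L} = (\dim Z + 4)%N.

(** Completing X by a basis of Z meet M, where M = <X> + D, gives a basis of M
    because <X> is a complement of Z. The rest of the basis of L is taken in Z.
    The bound on k comes from dim M <= 4 + dim D. *)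
Lemma adapted_basis (X : seq L) : size X = 4%N -> free X ->
  (Z :&: <<X>> = 0)%VS -> (Z + <<X>> = fullv)%VS ->
  exists k r (E : k.-tuple L) (G : r.-tuple L),
  [/\ (4 <= k <= 6)%N, (k + r)%N = \dim {:L}, basis_of {:L} (E ++ G),
      forall j : 'I_r, G`_j \in Z
    & [/\ forall i, (i < 4)%N -> E`_i = X`_i, forall i, E`_(i + 4) \in Z
        & (D <= <<E>>)%VS]].
Proof.
move=> sX fX capX fullX.
pose M := (<<X>> + D)%VS.
pose f := vbasis (Z :&: M)%VS; pose G := vbasis (Z :\: M)%VS.
have sE : size (X ++ f) == (4 + \dim (Z :&: M))%N by rewrite size_cat sX size_tuple.
have spanf : <<f>>%VS = (Z :&: M)%VS by apply: span_basis (vbasisP _).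
have spanG : <<G>>%VS = (Z :\: M)%VS by apply: span_basis (vbasisP _).
exists (4 + \dim (Z :&: M))%N, (\dim (Z :\: M)), (Tuple sE), G.
have dimZM := dimv_cap_compl Z M; split; last 1 [split].
- rewrite leq_addr /= (_ : 6 = 4 + 2)%N // leq_add2l.
  have sub : (<<X>> + (Z :&: M) <= M)%VS by rewrite subv_add addvSl capvSr.
  have := dimvS sub; rewrite dimv_disjoint_sum; last first.
    by apply/eqP; rewrite -subv0 -capX [(Z :&: <<X>>)%VS]capvC capvS ?capvSl.
  have [] := dimv_add_leqif <<X>>%VS D.
  by rewrite dimD (eqnP fX) sX -/M => ? _ ?; lia.
- by rewrite codimZ; lia.
- rewrite basisEdim /= !span_cat spanf spanG -addvA [(_ :&: _ + _)%VS]addvC.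
  rewrite addv_diff_cap addvC fullX subvv !size_cat !size_tuple sX codimZ; lia.
- move=> j; apply: (subvP (diffvSl Z M)); apply: vbasis_mem.
  by rewrite mem_nth ?size_tuple.
- by move=> i i4; rewrite /= nth_cat sX i4.
- move=> i; rewrite /= nth_cat sX ltnNge leq_addl /= addnK.
  have [lti|gei] := ltnP i (size f); last by rewrite nth_default // mem0v.
  by apply: (subvP (capvSl Z M)); apply: vbasis_mem; rewrite mem_nth.
apply/subvP => d dD; rewrite /= span_cat spanf.
have := memvf d; rewrite -fullX => /memv_addP[z zZ [x xX dE]].
have zM : z \in M.
  rewrite -[z](addrK x) -dE memvB //; first exact: (subvP (addvSr _ _)).
  exact: (subvP (addvSl _ _)).
by rewrite dE addrC memv_add // memv_cap zZ.
Qed.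

(** M is the table algebra on 'rV_k; [lincomb E] identifies it with a subalgebra
    of L, so that no Lie structure has to be put on a subspace of L. *)
Lemma decomposition : exists (k : nat) (M : lieAlgType F),
    [/\ (4 <= k <= 6)%N, (k <= \dim {:L})%N, lie_family M k 2,
        lie_iso L (lie_dsum M (abelian_lie F (\dim {:L} - k)))
      & (exists (a b : 'rV[F]_k) (alpha : F)
                   (J : table_jacobi (M2_table a b alpha)),
              free [:: a; b] /\ lie_iso M (table_lie J)) \/
        (exists (a b : 'rV[F]_k) (beta gamma : F)
                   (J : table_jacobi (M3_table a b beta gamma)),
              [/\ free [:: a; b],
                  forall t : F, ~~ root ('X^2 + gamma *: 'X - beta%:P) t
                & lie_iso M (table_lie J)])].
Proof.
have [e1 [e2 [e3 [e4 [[e14 e23 e4N fr] M23]]]]] := M2_or_M3_frame dimD codimZ.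
have [fX capX fullX] := frame_span codimZ e14 e4N fr.
have pX : perm_eq [:: e1; e4; e2; e3] [:: e1; e2; e3; e4].
  by rewrite perm_cons (perm_catC [:: e4] [:: e2; e3]).
rewrite (eq_span (perm_mem pX)) in capX fullX; rewrite (perm_free pX) in fX.
have [k [r [E [G [k46 krE basisEG Gc [E4 Ec DE]]]]]] :=
  @adapted_basis [:: e1; e2; e3; e4] (erefl _) fX capX fullX.
have [k4 k6] := andP k46.
pose a := \row_i coord E i [lie e1, e2]; pose b := \row_i coord E i [lie e1, e3].
have aE : lincomb E a = [lie e1, e2].
  by rewrite lincomb_coord // (subvP DE) // mem_lie_derived.
have bE : lincomb E b = [lie e1, e3].
  by rewrite lincomb_coord // (subvP DE) // mem_lie_derived.
have fab : free [:: a; b].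
  apply/free2P => c d cd0; apply: (free2P _ _ fr).
  by rewrite -aE -bE -!linearZ -linearD cd0 linear0.
have iso_refl M : lie_iso M M.
  by exists idfun; split; first exact: inv_bij.
have rE : (\dim {:L} - k = r)%N by rewrite -krE addKn.
have ltk : (2 < k)%N by lia.
have realize (c : bracket_table F k) :
    (forall i j, c i (j + 4)%N = 0) -> (forall i j, c i j \in <<[:: a; b]>>%VS) ->
    c 0%N 1%N = a -> c 0%N 2%N = b -> c 0%N 3%N = 0 -> c 1%N 2%N = 0 ->
    lincomb E (c 1%N 3%N) = [lie e2, e4] -> lincomb E (c 2%N 3%N) = [lie e3, e4] ->
    exists J : table_jacobi c, lie_family (table_lie J) k 2 /\
      lie_iso L (lie_dsum (table_lie J) (abelian_lie F (\dim {:L} - k))).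
  move=> c4 cab c01 c02 c03 c12 c13 c23.
  have brE (i j : 'I_k) : (i < j)%N -> [lie E`_i, E`_j] = lincomb E (c i j).
    move: i j => [i lti] [j ltj] /= ltij.
    have [j4|j4] := ltnP j 4; last first.
      by rewrite -(subnK j4) c4 linear0 lbr_center.
    rewrite !E4 ?(ltn_trans ltij) //.
    case: j ltij j4 {ltj} => [|[|[|[|//]]]] //.
    - by case: i lti => //= *; rewrite c01.
    - by case: i lti => [|[|//]] //= *; rewrite ?c02 // c12 linear0.
    - by case: i lti => [|[|[|//]]] //= *; rewrite ?c13 ?c23 // c03 linear0.
  exists (table_jacobi_of_basis basisEG brE).
  by split; [apply: table_lie_family cab | rewrite rE; apply: lie_iso_of_basis].
have kn : (k <= \dim {:L})%N by rewrite -krE leq_addr.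
case: M23 => [[alpha [e24 e34]]|[beta [gamma [noroot e24 e34]]]].
- have [||||||||J [famJ isoJ]] := @realize (M2_table a b alpha) => //.
  + exact: M2_table_tail.
  + exact: M2_table_span.
  + by rewrite linear0 e24.
  + by rewrite linearD linearZ /= aE bE e34.
  exists k, (table_lie J); split=> //.
  by left; exists a, b, alpha, J.
- have [||||||||J [famJ isoJ]] := @realize (M3_table a b beta gamma) => //.
  + exact: M3_table_tail.
  + exact: M3_table_span.
  + by rewrite bE e24.
  + by rewrite linearD !linearZ /= aE bE e34.
  exists k, (table_lie J); split=> //.
  by right; exists a, b, beta, gamma, J.
Qed.

End Decomposition.

(** * Distances in commuting graphs *)

Section Walks.
Variables (T : eqType) (e : rel T).

(** A walk with repetitions and stationary steps is shortened to a simple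
    path. *)
Lemma walk_graph_path (x : T) q : path (fun u v => (u == v) || e u v) x q ->
  exists2 p, graph_path e x (last x q) p & (size p <= size q)%N.
Proof.
move=> xq; have [p xp [lp sp]] : exists2 p, path e x p &
    last x p = last x q /\ (size p <= size q)%N.
  elim: q x xq => [|y q IH] x /=; first by exists [::].
  case/andP=> xy /IH[p yp [lp sp]]; case/orP: xy => [/eqP->|xy].
    by exists p => //; split=> //; apply: leqW.
  by exists (y :: p); rewrite /= ?xy.
rewrite -lp; case/shortenP: xp => p' xp' up' subp; exists p'.
  by rewrite /graph_path xp' eqxx.
by apply: leq_trans sp; apply: uniq_leq_size => //; case/andP: up'.
Qed.

End Walks.

Section CommutingGraph.
Variables (F : fieldType) (L : lieAlgType F).
Local Notation Z := (lie_center L).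

(** Distances are at most 3 by the first hypothesis, and the second one provides
    two vertices without a common neighbour; taking u = x there shows that they do
    not commute, as x is noncentral. *)
Lemma commuting_diameter3 :
  (forall x y : L, x \notin Z -> y \notin Z -> exists u v,
     [/\ u \notin Z, v \notin Z
       & [/\ [lie x, u] = 0, [lie u, v] = 0 & [lie v, y] = 0]]) ->
  (exists x y : L, [/\ x \notin Z, y \notin Z
     & forall u, [lie x, u] = 0 -> [lie u, y] = 0 -> u \in Z]) ->
  graph_connected (commuting L) /\ graph_diameter (commuting L) 3.
Proof.
move=> chain [x0 [y0 [x0N y0N sep]]].
have short (x y : noncentral L) :
    exists2 p, graph_path (commuting L) x y p & (size p <= 3)%N.
  have [u [v [uN vN [xu uv vy]]]] := chain _ _ (valP x) (valP y).
  pose u' : noncentral L := Sub u uN; pose v' : noncentral L := Sub v vN.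
  apply: (@walk_graph_path _ _ x [:: u'; v'; y]).
  by rewrite /= /commuting xu uv vy eqxx !andbT !orbN.
have dist3 x y d : graph_dist (commuting L) x y d -> (d <= 3)%N.
  by case=> _ min; have [p /min dp p3] := short x y; apply: leq_trans dp p3.
split=> [x y _|]; first by have [p] := short x y; exists p.
split=> [x y d _|m bound]; first exact: dist3.
have xyN0 : [lie x0, y0] != 0.
  by apply: contra x0N => /eqP xy0; rewrite sep // lbrxx.
pose x : noncentral L := Sub x0 x0N; pose y : noncentral L := Sub y0 y0N.
have xy : x != y by apply: contraNneq xyN0 => /(congr1 val) /= ->; rewrite lbrxx.
have long p : graph_path (commuting L) x y p -> (3 <= size p)%N.
  case: p => [|u [|v [|w p]]] //=; rewrite /graph_path /= /commuting.
  - by rewrite (negPf xy).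
  - by case/and3P=> /andP[/andP[_ xu]] _ /eqP uy; rewrite uy /= (negPf xyN0) in xu.
  - case/and3P=> /and3P[/andP[_ /eqP xu] /andP[_ /eqP uv] _] /eqP vy _.
    by have := valP u; rewrite sep // -[y0]/(val y) -vy.
have [p pxy p3] := short x y; apply: (bound x y) => //; split=> //.
by exists p => //; apply/eqP; rewrite eqn_leq p3 long.
Qed.

(** The walk is x, T x, S y, y when T x and S y are noncentral, or
    x, S x, T y, y. In the other cases, a central T x makes x commute with the
    whole image of T, because [x, T z] = [T x, z], and likewise for S. *)
Lemma selfadjoint_pair_diameter3 (T S : L -> L) :
  (forall x y, [lie T x, y] = [lie x, T y]) ->
  (forall x y, [lie S x, y] = [lie x, S y]) ->
  (forall x, [lie x, T x] = 0) -> (forall x, [lie x, S x] = 0) ->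
  (forall x y, [lie T x, S y] = 0) ->
  (exists x, T x \notin Z) -> (exists x, S x \notin Z) ->
  (exists x y : L, [/\ x \notin Z, y \notin Z
     & forall u, [lie x, u] = 0 -> [lie u, y] = 0 -> u \in Z]) ->
  graph_connected (commuting L) /\ graph_diameter (commuting L) 3.
Proof.
move=> Tadj Sadj xTx xSx TS [t tN] [s sN].
apply: commuting_diameter3 => x y xN yN.
have Tkill v z : T v \in Z -> [lie v, T z] = 0 by rewrite -Tadj => /lie_centerP->.
have Skill v z : S v \in Z -> [lie v, S z] = 0 by rewrite -Sadj => /lie_centerP->.
have [Tx|Tx] := boolP (T x \in Z); have [Ty|Ty] := boolP (T y \in Z).
- exists (T t), (T t); split=> //; split; rewrite ?lbrxx ?Tkill //.
  by rewrite lbr_eq0C ?Tkill.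
- have [Sx|Sx] := boolP (S x \in Z); last first.
    by exists (S x), (T y); split=> //; split=> //; rewrite lbr_eq0C.
  by exists x, (T y); split=> //; split; rewrite ?lbrxx ?Tkill // lbr_eq0C.
- have [Sy|Sy] := boolP (S y \in Z); last first.
    by exists (T x), (S y); split=> //; split=> //; rewrite lbr_eq0C.
  by exists (T x), y; split=> //; split; rewrite ?lbrxx // Tadj lbr_center.
- have [Sy|Sy] := boolP (S y \in Z); last first.
    by exists (T x), (S y); split=> //; split=> //; rewrite lbr_eq0C.
  have [Sx|Sx] := boolP (S x \in Z); last first.
    by exists (S x), (T y); split=> //; split; rewrite // lbr_eq0C.
  exists (S s), (S s); split=> //; split; rewrite ?lbrxx ?Skill //.
  by rewrite lbr_eq0C ?Skill.
Qed.

(** A path starting at x0 never leaves the centralizer of x0. *)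
Lemma transitive_disconnected :
  (forall x y z : L, y \notin Z ->
     [lie x, y] = 0 -> [lie y, z] = 0 -> [lie x, z] = 0) ->
  (exists x y : L, [lie x, y] != 0) -> ~ graph_connected (commuting L).
Proof.
move=> trans [x0 [y0 xy0]] conn.
have x0N : x0 \notin Z by apply: contra xy0 => /lie_centerP->.
have y0N : y0 \notin Z by apply: contra xy0 => /(lbr_center x0)->.
pose x : noncentral L := Sub x0 x0N; pose y : noncentral L := Sub y0 y0N.
have xy : x != y by apply: contraNneq xy0 => /(congr1 val) /= ->; rewrite lbrxx.
have [p /and3P[xp /eqP lp _]] := conn x y xy.
have far q (u : noncentral L) : [lie x0, val u] = 0 -> path (commuting L) u q ->
    [lie x0, val (last u q)] = 0.
  elim: q u => [|v q IH] u //= xu /andP[/andP[_ /eqP uv]]; apply: IH.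
  exact: trans (valP u) xu uv.
by case/eqP: xy0; rewrite -[y0]/(val y) -lp; apply: far xp; apply: lbrxx.
Qed.

End CommutingGraph.

(** * The commuting graphs of the three tables *)

Section Coordinates.
Variables (F : fieldType) (k : nat) (k4 : (4 <= k)%N).
Implicit Types x y a b : 'rV[F]_k.

Definition crd x (i : nat) : F := x 0 (widen_ord k4 (inord i)).

Definition vec4 (s : seq F) : 'rV[F]_k := \row_i s`_i.

Lemma crd_vec4 s i : (i < 4)%N -> crd (vec4 s) i = s`_i.
Proof. by move=> i4; rewrite /crd mxE /= inordK. Qed.

Definition plucker x y i j := crd x i * crd y j - crd x j * crd y i.

Lemma table_lbr4 (c : bracket_table F k) x y :
  (forall i j, c i (j + 4)%N = 0) ->
  table_lbr c x y =
    plucker x y 0 1 *: c 0%N 1%N + plucker x y 0 2 *: c 0%N 2%N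
  + plucker x y 0 3 *: c 0%N 3%N + plucker x y 1 2 *: c 1%N 2%N
  + plucker x y 1 3 *: c 1%N 3%N + plucker x y 2 3 *: c 2%N 3%N.
Proof.
move=> c4; rewrite /table_lbr.
pose h i j := plucker x y i j *: c i j.
transitivity (\sum_(i < 4) \sum_(j < 4) if (i < j)%N then h i j else 0).
  transitivity (\sum_(i < k | (i < 4)%N) \sum_(j < k | (i < j)%N && (j < 4)%N) h i j).
    rewrite [LHS](bigID (fun i : 'I_k => (i < 4)%N)) /=.
    rewrite [X in _ + X]big1 ?addr0; last first.
      move=> i; rewrite -leqNgt => i4; rewrite big1 // => j ij.
      by rewrite -[nat_of_ord j](@subnK 4) ?c4 ?scaler0 //; lia.
    apply: eq_bigr => i i4; rewrite [LHS](bigID (fun j : 'I_k => (j < 4)%N)) /=.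
    rewrite [X in _ + X]big1 ?addr0; last first.
      move=> j; rewrite -leqNgt => /andP[_ j4].
      by rewrite -[nat_of_ord j](@subnK 4) ?c4 ?scaler0 //; lia.
    apply: eq_bigr => j /andP[_ j4]; rewrite /h /plucker /crd.
    have -> : widen_ord k4 (inord i) = i by apply: val_inj; rewrite /= inordK.
    by have -> : widen_ord k4 (inord j) = j by apply: val_inj; rewrite /= inordK.
  rewrite (big_ord_narrow k4); apply: eq_bigr => i _ /=.
  by rewrite (big_ord_narrow_cond k4) big_mkcond.
rewrite !big_ord_recl !big_ord0 /= /bump /= !add0r !addr0.
by rewrite /h !addrA.
Qed.

Lemma M1_lbr a b x y : table_lbr (M1_table a b) x y =
  plucker x y 0 1 *: a + plucker x y 2 3 *: b.
Proof.
by rewrite table_lbr4 /= ?scaler0 ?addr0 //; apply: M1_table_tail.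
Qed.

Lemma M2_lbr a b alpha x y : table_lbr (M2_table a b alpha) x y =
  (plucker x y 0 1 + plucker x y 2 3) *: a
  + (plucker x y 0 2 + alpha * plucker x y 2 3) *: b.
Proof.
by rewrite table_lbr4 /=; [vec_ring | apply: M2_table_tail].
Qed.

Lemma M3_lbr a b beta gamma x y : table_lbr (M3_table a b beta gamma) x y =
  (plucker x y 0 1 + beta * plucker x y 2 3) *: a
  + (plucker x y 0 2 + plucker x y 1 3 + gamma * plucker x y 2 3) *: b.
Proof.
by rewrite table_lbr4 /=; [vec_ring | apply: M3_table_tail].
Qed.

Lemma crd0_center (c : bracket_table F k) (J : table_jacobi c) (x : table_lie J) :
  (forall i j, c i (j + 4)%N = 0) -> (forall i, (i < 4)%N -> crd x i = 0) ->
  x \in lie_center (table_lie J).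
Proof.
move=> c4 x0; apply/lie_centerP => y; rewrite -[LHS]/(table_lbr c x y) table_lbr4 //.
by rewrite /plucker !x0 // !mul0r subr0 !scale0r !addr0.
Qed.

Section Graphs.
Variables a b : 'rV[F]_k.
Hypothesis fab : free [:: a; b].

Lemma lincomb2_eq0 (c d : F) : c *: a + d *: b = 0 <-> c = 0 /\ d = 0.
Proof. by split=> [/(free2P _ _ fab)//|[-> ->]]; rewrite !scale0r addr0. Qed.

Ltac plucker_ring := rewrite /plucker ?crd_vec4 //=; ring.

(** L/Z is the sum of the planes <e1, e2> and <e3, e4>, which are orthogonal to
    each other for the bracket, so that the projections T and S on them are
    self-adjoint. *)
Lemma M1_graph (J : table_jacobi (M1_table a b)) :
  graph_connected (commuting (table_lie J)) /\
  graph_diameter (commuting (table_lie J)) 3.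
Proof.
have lbrT (x y : table_lie J) :
    [lie x, y] = plucker x y 0 1 *: a + plucker x y 2 3 *: b.
  exact: M1_lbr.
have noncentral (x y : table_lie J) : plucker x y 0 1 = 1 \/ plucker x y 2 3 = 1 ->
    x \notin lie_center _.
  move=> h; apply/negP => /lie_centerP/(_ y); rewrite lbrT => /lincomb2_eq0[h1 h2].
  by case: h; rewrite ?h1 ?h2 => /esym/eqP; rewrite oner_eq0.
pose e s : table_lie J := vec4 s.
pose T (x : table_lie J) := e [:: crd x 0; crd x 1; 0; 0].
pose S (x : table_lie J) := e [:: 0; 0; crd x 2; crd x 3].
apply: (@selfadjoint_pair_diameter3 _ _ T S).
- by move=> x y; rewrite !lbrT; congr (_ *: _ + _ *: _); plucker_ring.
- by move=> x y; rewrite !lbrT; congr (_ *: _ + _ *: _); plucker_ring.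
- by move=> x; rewrite lbrT; apply/lincomb2_eq0; split; plucker_ring.
- by move=> x; rewrite lbrT; apply/lincomb2_eq0; split; plucker_ring.
- by move=> x y; rewrite lbrT; apply/lincomb2_eq0; split; plucker_ring.
- exists (e [:: 1; 0; 0; 0]).
  by apply: (noncentral _ (e [:: 0; 1; 0; 0])); left; plucker_ring.
- exists (e [:: 0; 0; 1; 0]).
  by apply: (noncentral _ (e [:: 0; 0; 0; 1])); right; plucker_ring.
(* Commuting with e1 + e3 makes the components in the two planes multiples of e1
   and e3; commuting with e2 + e4 makes them multiples of e2 and e4. *)
exists (e [:: 1; 0; 1; 0]), (e [:: 0; 1; 0; 1]); split.
- by apply: (noncentral _ (e [:: 0; 1; 0; 0])); left; plucker_ring.
- by apply: (noncentral (e _) (e [:: -1; 0; 0; 0])); left; plucker_ring.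
move=> u; rewrite !lbrT => /lincomb2_eq0[u1 u3] /lincomb2_eq0[u0 u2].
apply: (crd0_center (@M1_table_tail _ _ _ _)).
case=> [|[|[|[|//]]]] _; [rewrite -[RHS]u0 | rewrite -[RHS]u1
  | rewrite -[RHS]u2 | rewrite -[RHS]u3]; plucker_ring.
Qed.

(** The operator T, with T e1 = e4 and T e3 = - e2 - alpha e3, satisfies
    T (T + alpha) = 0 and makes L/Z a free F[T]-module with basis e1, e3. After
    identification of <a, b> with F[T] the bracket is the determinant in this
    basis, so that T and S = T + alpha are self-adjoint. *)
Lemma M2_graph alpha (J : table_jacobi (M2_table a b alpha)) :
  graph_connected (commuting (table_lie J)) /\
  graph_diameter (commuting (table_lie J)) 3.
Proof.
have lbrT (x y : table_lie J) : [lie x, y] = (plucker x y 0 1 + plucker x y 2 3) *: a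
    + (plucker x y 0 2 + alpha * plucker x y 2 3) *: b.
  exact: M2_lbr.
have noncentral (x y : table_lie J) : plucker x y 0 1 + plucker x y 2 3 = 1 ->
    x \notin lie_center _.
  move=> h; apply/negP => /lie_centerP/(_ y); rewrite lbrT h => /lincomb2_eq0[/eqP].
  by rewrite oner_eq0.
pose e s : table_lie J := vec4 s.
pose T (x : table_lie J) :=
  e [:: 0; - crd x 2; - (alpha * crd x 2); crd x 0 - alpha * crd x 3].
pose S (x : table_lie J) :=
  e [:: alpha * crd x 0; alpha * crd x 1 - crd x 2; 0; crd x 0].
apply: (@selfadjoint_pair_diameter3 _ _ T S).
- by move=> x y; rewrite !lbrT; congr (_ *: _ + _ *: _); plucker_ring.
- by move=> x y; rewrite !lbrT; congr (_ *: _ + _ *: _); plucker_ring.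
- by move=> x; rewrite lbrT; apply/lincomb2_eq0; split; plucker_ring.
- by move=> x; rewrite lbrT; apply/lincomb2_eq0; split; plucker_ring.
- by move=> x y; rewrite lbrT; apply/lincomb2_eq0; split; plucker_ring.
- exists (e [:: 1; 0; 0; 0]).
  by apply: (noncentral _ (e [:: 0; 0; -1; 0])); plucker_ring.
- exists (e [:: 1; 0; 0; 0]).
  by apply: (noncentral _ (e [:: 0; 0; -1; 0])); plucker_ring.
(* Modulo the center, the centralizers of e1 and e3 are the complementary planes
   F[T] e1 = <e1, e4> and F[T] e3 = <e2, e3>. *)
exists (e [:: 1; 0; 0; 0]), (e [:: 0; 0; 1; 0]); split.
- by apply: (noncentral _ (e [:: 0; 1; 0; 0])); plucker_ring.
- by apply: (noncentral (e _) (e [:: 0; 0; 0; 1])); plucker_ring.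
move=> u; rewrite !lbrT => /lincomb2_eq0[u1 u2] /lincomb2_eq0[u3 u0].
apply: (crd0_center (@M2_table_tail _ _ _ _ _)).
have u30 : crd u 3 = 0 by rewrite -[RHS]oppr0 -[in RHS]u3; plucker_ring.
case=> [|[|[|[|//]]]] _ //.
- by rewrite -[RHS]u0; move: u30; rewrite /plucker !crd_vec4 //= => ->; ring.
- by rewrite -[RHS]u1; plucker_ring.
- by rewrite -[RHS]u2; plucker_ring.
Qed.

(** Let K = F[tau] with tau^2 = beta + gamma tau. The coordinates (x0, .., x3)
    stand for the vector X = (x0 - tau x3, x1 + tau x2) of K^2, and f1 + tau f2 is
    the determinant of X and Y. Transitivity for a nonzero Y follows from
    Y_i det(X, Z) = X_i det(Y, Z) + Z_i det(X, Y) and from the absence of zero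
    divisors in K, whose norm form is u^2 + gamma u v - beta v^2. *)
Lemma M3_disconnected beta gamma (J : table_jacobi (M3_table a b beta gamma)) :
  (forall t : F, ~~ root ('X^2 + gamma *: 'X - beta%:P) t) ->
  ~ graph_connected (commuting (table_lie J)).
Proof.
move=> noroot.
pose f1 (x y : table_lie J) := plucker x y 0 1 + beta * plucker x y 2 3.
pose f2 (x y : table_lie J) :=
  plucker x y 0 2 + plucker x y 1 3 + gamma * plucker x y 2 3.
have lbrT (x y : table_lie J) : [lie x, y] = f1 x y *: a + f2 x y *: b.
  exact: M3_lbr.
have norm_neq0 (u v : F) : u * u + gamma * u * v - beta * v * v = 0 -> u = 0 /\ v = 0.
  have [->|v0 uv] := eqVneq v 0.
    by rewrite !mulr0 subr0 addr0 => /eqP; rewrite mulf_eq0 orbb => /eqP.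
  case/negP: (noroot (u / v)); apply/rootP.
  rewrite !(hornerD, hornerN, hornerZ, hornerXn, hornerX, hornerC).
  transitivity ((u * u + gamma * u * v - beta * v * v) / (v * v)); first by field.
  by rewrite uv mul0r.
have domain (u v w1 w2 : F) : u * w1 + beta * v * w2 = 0 ->
    u * w2 + v * w1 + gamma * v * w2 = 0 -> (u = 0 /\ v = 0) \/ (w1 = 0 /\ w2 = 0).
  move=> h1 h2.
  have [/norm_neq0|N] := eqVneq (u * u + gamma * u * v - beta * v * v) 0.
    by left.
  right; split; apply/eqP; rewrite -(mulrI_eq0 _ (mulfI N)); apply/eqP.
    transitivity ((u + gamma * v) * (u * w1 + beta * v * w2)
      - beta * v * (u * w2 + v * w1 + gamma * v * w2)); first by ring.
    by rewrite h1 h2 !mulr0 subr0.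
  transitivity (u * (u * w2 + v * w1 + gamma * v * w2) - v * (u * w1 + beta * v * w2)).
    by ring.
  by rewrite h1 h2 !mulr0 subr0.
apply: transitive_disconnected.
  (* The hypotheses of [domain] say that (u + tau v) (w1 + tau w2) = 0; it is
     used for u + tau v = Y_1, then Y_2. *)
  move=> x y z yN; rewrite !lbrT => /lincomb2_eq0[xy1 xy2] /lincomb2_eq0[yz1 yz2].
  apply/lincomb2_eq0.
  have zero (p q r s : F) : p * f1 y z + q * f2 y z + (r * f1 x y + s * f2 x y) = 0.
    by rewrite xy1 xy2 yz1 yz2 !mulr0 !addr0.
  have [||[y0 y3]|//] := @domain (crd y 0) (- crd y 3) (f1 x z) (f2 x z).
  - rewrite -(zero (crd x 0) (- beta * crd x 3) (crd z 0) (- beta * crd z 3)) /f1 /f2.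
    by plucker_ring.
  - rewrite -(zero (- crd x 3) (crd x 0 - gamma * crd x 3)
      (- crd z 3) (crd z 0 - gamma * crd z 3)) /f1 /f2.
    by plucker_ring.
  have [||[y1 y2]|//] := @domain (crd y 1) (crd y 2) (f1 x z) (f2 x z).
  - rewrite -(zero (crd x 1) (beta * crd x 2) (crd z 1) (beta * crd z 2)) /f1 /f2.
    by plucker_ring.
  - rewrite -(zero (crd x 2) (crd x 1 + gamma * crd x 2)
      (crd z 2) (crd z 1 + gamma * crd z 2)) /f1 /f2.
    by plucker_ring.
  case/negP: yN; apply: (crd0_center (@M3_table_tail _ _ _ _ _ _)).
  by case=> [|[|[|[|//]]]] _ //; apply/eqP; rewrite -oppr_eq0 y3.
pose e s : table_lie J := vec4 s.
exists (e [:: 1; 0; 0; 0]), (e [:: 0; 1; 0; 0]); rewrite lbrT.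
apply/eqP => /lincomb2_eq0[/eqP + _]; rewrite /f1 /plucker !crd_vec4 //=.
by rewrite !(mulr0, mul0r, subr0, addr0, mulr1) oner_eq0.
Qed.

End Graphs.

End Coordinates.

(** * The classification theorem *)

Theorem theorem28 (F : fieldType) (n : nat) (hn : (4 <= n)%N)
  (L : lieAlgType F) (hL : lie_family L n 2)
  (hZ : \dim (lie_center L) = (n - 4)%N) :
  (exists (k : nat) (M : lieAlgType F),
    [/\ (4 <= k <= 6)%N, (k <= n)%N, lie_family M k 2,
        lie_iso L (lie_dsum M (abelian_lie F (n - k)))
      & [\/ exists (a b : 'rV[F]_k) (J : table_jacobi (M1_table a b)),
              free [:: a; b] /\ lie_iso M (table_lie J),
            exists (a b : 'rV[F]_k) (alpha : F)
                   (J : table_jacobi (M2_table a b alpha)),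
              free [:: a; b] /\ lie_iso M (table_lie J)
          | exists (a b : 'rV[F]_k) (beta gamma : F)
                   (J : table_jacobi (M3_table a b beta gamma)),
              [/\ free [:: a; b],
                  forall t : F, ~~ root ('X^2 + gamma *: 'X - beta%:P) t
                & lie_iso M (table_lie J)]]]) /\
  (forall (k : nat) (a b : 'rV[F]_k), (4 <= k <= 6)%N -> free [:: a; b] ->
    [/\ forall J : table_jacobi (M1_table a b),
          graph_connected (commuting (table_lie J)) /\
          graph_diameter (commuting (table_lie J)) 3,
        forall (alpha : F) (J : table_jacobi (M2_table a b alpha)),
          graph_connected (commuting (table_lie J)) /\
          graph_diameter (commuting (table_lie J)) 3
      & forall (beta gamma : F) (J : table_jacobi (M3_table a b beta gamma)),
          (forall t : F, ~~ root ('X^2 + gamma *: 'X - beta%:P) t) ->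
          ~ graph_connected (commuting (table_lie J))]).
Proof.
have [dimL dimD] := hL.
have codimZ : \dim {:L} = (\dim (lie_center L) + 4)%N by rewrite dimL hZ subnK.
split; last first.
  move=> k a b /andP[k4 _] fab; split.
  - by move=> J; apply: (M1_graph k4 fab J).
  - by move=> alpha J; apply: (M2_graph k4 fab J).
  - by move=> beta gamma J noroot; apply: (M3_disconnected k4 fab).
have [k [M [k46 kn famM isoM M23]]] := decomposition dimD codimZ.
exists k, M; rewrite dimL in kn isoM; split=> //.
by case: M23 => M23; [constructor 2 | constructor 3].
Qed.
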